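(* Let $x:I\subset\mathbb{R}\to\mathbb{E}^3$ be a twisted curve with $\kappa_1>0$ and let $s$ be its arclength function. Write $x(s)=m_0(s)T(s)+m_1(s)N_1(s)+m_2(s)N_2(s)$. If $x$ is a $W$-curve of $\mathbb{E}^3$, then the position vector $x$ is given by the functions $$m_0(s)=\kappa_1\left(\frac{c_3\sin as-c_2\cos as}{a}-bs\right)+s+c_0,$$ $$m_1(s)=c_2\sin as+c_3\cos as-b,$$ $$m_2(s)=-\kappa_2\left(\frac{c_3\sin as-c_2\cos as}{a}-bs\right)+c_1,$$ where $c_0,c_1,c_2,c_3$ are (integration) constants and $a=\sqrt{\kappa_1^2+\kappa_2^2}$, $b=\frac{\kappa_1}{a^2}$ are real constants.
   Context: For a unit speed curve $x(s)$ in Euclidean 3-space $\mathbb{E}^3$, the Frenet frame $T=x'$, $N_1$, $N_2=T\times N_1$ and curvature $\kappa_1=\|x''\|$, torsion $\kappa_2$ satisfy $T'=\kappa_1N_1$, $N_1'=-\kappa_1T+\kappa_2N_2$, $N_2'=-\kappa_2N_1$. A curve is twisted if $\kappa_1$ and $\kappa_2$ are nowhere zero. A $W$-curve is a curve whose curvatures $\kappa_1$ and $\kappa_2$ are both constant functions. The position vector of the curve is also denoted by $x$. *)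

(* Defs.v *)
From mathcomp Require Import all_boot all_order all_algebra.
From mathcomp Require Import all_classical all_reals all_analysis.
Set Implicit Arguments.
Unset Strict Implicit.
Unset Printing Implicit Defensive.
Import Order.TTheory GRing.Theory Num.Theory.
Import numFieldNormedType.Exports.
Local Open Scope classical_set_scope.
Local Open Scope ring_scope.

(* The derivative of f : I -> V at a point of I.  The increments h are those with
   h + s in I, so that the limit is one-sided at an endpoint belonging to I, and
   only the restriction of f to I matters.  At interior points this is the
   library's derive1 (lemma derive_onE). *)
Definition increments (R : realType) (I : set R) (s : R) : set_system R :=
  within [set h | I (h + s)] 0^'.

Definition derivable_on (R : realType) (V : normedModType R) (I : set R)
  (f : R -> V) : Prop :=
  forall s, I s -> cvg (h^-1 *: (f (h + s) - f s) @[h --> increments I s]).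

Definition derive_on (R : realType) (V : normedModType R) (I : set R)
  (f : R -> V) (s : R) : V :=
  lim (h^-1 *: (f (h + s) - f s) @[h --> increments I s]).

Lemma increments_interior (R : realType) (I : set R) (s : R) :
  I° s -> increments I s = 0^'.
Proof.
rewrite /interior /= => Is.
have sI : \forall h \near (0 : R)^', I (h + s).
  apply: nbhs_dnbhs; move: Is.
  by rewrite -[nbhs s I]/(\near s, I s) (near_shift 0) subr0.
rewrite /increments; apply/seteqP; split => A; rewrite /within /=.
- by move=> IA; move: sI IA; apply: filterS2 => h Ih; apply.
- by apply: filterS => h Ah _.
Qed.

Lemma derive_onE (R : realType) (V : normedModType R) (I : set R) (f : R -> V)
  (s : R) : I° s -> derive_on I f s = derive1 f s.
Proof. by move=> Is; rewrite /derive_on increments_interior. Qed.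

(* Points of E^3 are row vectors.  The norm `|_| that the library puts on
   'rV[R]_3 is the sup norm, hence the separate Euclidean norm; the sup norm only
   serves to define the (same) topology in which derivatives are taken. *)
Definition dot (R : realType) (u v : 'rV[R]_3) : R := \sum_(i < 3) u 0 i * v 0 i.

Definition enorm (R : realType) (u : 'rV[R]_3) : R := Num.sqrt (dot u u).

(* Indices live in 'I_3 = Z/3, so i + 1 and i + 2 are cyclic shifts. *)
Definition cross (R : realType) (u v : 'rV[R]_3) : 'rV[R]_3 :=
  \row_(i < 3) (u 0 (i + 1) * v 0 (i + 2%:R) - u 0 (i + 2%:R) * v 0 (i + 1)).

Section FrenetFrame.
Variables (R : realType) (I : set R) (x : R -> 'rV[R]_3).

Definition frenetT : R -> 'rV[R]_3 := derive_on I x.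

Definition curvature (s : R) : R := enorm (derive_on I frenetT s).

Definition frenetN1 (s : R) : 'rV[R]_3 :=
  (curvature s)^-1 *: derive_on I frenetT s.

Definition frenetN2 (s : R) : 'rV[R]_3 := cross (frenetT s) (frenetN1 s).

(* The N_2-component of N_1' = - kappa_1 T + kappa_2 N_2. *)
Definition torsion (s : R) : R := dot (derive_on I frenetN1 s) (frenetN2 s).

(* I is a nondegenerate interval, x is three times differentiable on I and
   is parametrized by arclength. *)
Definition unit_speed_curve : Prop :=
  [/\ is_interval I, I° !=set0,
      [/\ derivable_on I x, derivable_on I frenetT &
          derivable_on I (derive_on I frenetT)] &
      forall s, I s -> enorm (frenetT s) = 1].

Definition twisted : Prop :=
  forall s, I s -> curvature s != 0 /\ torsion s != 0.

(* The parameters k1 and k2 name the constant values of the two curvatures. *)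
Definition W_curve (k1 k2 : R) : Prop :=
  forall s, I s -> curvature s = k1 /\ torsion s = k2.

End FrenetFrame.

(* Main.v *)
Require Import Defs.
From mathcomp Require Import all_boot all_order all_algebra.
From mathcomp Require Import all_classical all_reals all_analysis.
From mathcomp Require Import ring lra.
Set Implicit Arguments.
Unset Strict Implicit.
Unset Printing Implicit Defensive.
Import Order.TTheory GRing.Theory Num.Theory.
Import numFieldNormedType.Exports.
Local Open Scope classical_set_scope.
Local Open Scope ring_scope.

(** The frame (T, N1, N2) is orthonormal, so the coordinates of the position
    vector are m0 = x.T, m1 = x.N1, m2 = x.N2.  Differentiating these dot products
    and using the orthonormality relations gives a linear system with constant
    coefficients ([position_derive]):
      m0' = 1 + k1 m1,   m1' = - k1 m0 + k2 m2,   m2' = - k2 m1.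
    Put P = m1 + b and Q = m1'.  Then P' = Q and Q' = - a^2 P: a harmonic
    oscillator of frequency a.  Its two first integrals
      c2 = P sin(as) + Q cos(as) / a,   c3 = P cos(as) - Q sin(as) / a
    recover P and Q by a rotation of angle as.  A third first integral is
    k2 m0 + k1 m2 - k2 s.  Together with Q = - k1 m0 + k2 m2 it is a linear system
    in (m0, m2) of determinant k1^2 + k2^2 = a^2, which is solved by Cramer's rule
    ([W_curve_ode_solution]).

    Only differentiability relative to the interval I is available, so the
    calculus is redone for difference quotients restricted to I.  Two facts
    there depend on the shape of I.  Since I is a nondegenerate interval,
    derivatives are unique, which turns constancy of a dot product into an identity
    between derivatives; since I is an interval, a function of zero derivative is
    constant, which yields the integration constants. *)

(** * Differentiation relative to a subset of the line *)

#[local] Instance increments_filter (R : realType) (I : set R) (s : R) :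
  Filter (increments I s).
Proof. exact: within_filter. Qed.

(** A relation rather than the limit operator [derive_on], so that the rules below
    produce existence and value of a derivative together. *)
Definition has_derive_on (R : realType) (I : set R) (f : R -> R) (s l : R) :=
  h^-1 * (f (h + s) - f s) @[h --> increments I s] --> l.

Section ScalarCalculus.
Variables (R : realType) (I : set R).
Implicit Types (f g : R -> R) (s l : R).

(** Nonzero increments of arbitrarily small size exist at every point of I, because
    I contains a second point and hence the segment towards it. *)
Lemma increments_proper s : is_interval I -> I° !=set0 -> I s ->
  ProperFilter (increments I s).
Proof.
move=> itvI [p Ip] Is.
have [t It ts] : exists2 t, I t & t != s.
  have [eps|neps] := eqVneq p s; last by exists p => //; exact: interior_subset.
  move: Ip; rewrite eps /interior /= => /nbhs_ballP[e /= e0 sube].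
  exists (s + e / 2); last by rewrite gt_eqF// ltrDl divr_gt0.
  apply: sube; rewrite /ball /= opprD addrA subrr sub0r normrN gtr0_norm ?divr_gt0//.
  by rewrite gtr_pMr// invf_lt1// ltr1n.
apply: Build_ProperFilter_ex => A /nbhs_ballP[e /= e0 sube].
(* It is enough to take h of size at most e / 2 pointing from s towards t. *)
suff [h [h0 he Ihs]] : exists h : R, [/\ h != 0, `|h| < e & I (h + s)].
  by exists h; apply: sube => //; rewrite /ball /= sub0r normrN.
case: (ltgtP s t) ts => // st _.
- pose m := Num.min (t - s) (e / 2); exists m.
  have [m0 me mt] : [/\ 0 < m, m <= e / 2 & m <= t - s].
    by split; rewrite ?lt_min ?ge_min ?lexx ?orbT// subr_gt0 st divr_gt0.
  split; first by rewrite gt_eqF.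
    by rewrite gtr0_norm// (le_lt_trans me)// gtr_pMr// invf_lt1// ltr1n.
  by apply: (itvI s t) => //; apply/andP; split; lra.
- pose m := Num.min (s - t) (e / 2); exists (- m).
  have [m0 me mt] : [/\ 0 < m, m <= e / 2 & m <= s - t].
    by split; rewrite ?lt_min ?ge_min ?lexx ?orbT// subr_gt0 st divr_gt0.
  split; first by rewrite oppr_eq0 gt_eqF.
    by rewrite normrN gtr0_norm// (le_lt_trans me)// gtr_pMr// invf_lt1// ltr1n.
  by apply: (itvI t s) => //; apply/andP; split; lra.
Qed.

Lemma near_increments_in s : \forall h \near increments I s, I (h + s).
Proof. exact: withinT. Qed.

Lemma near_increments_neq0 s : \forall h \near increments I s, h != 0.
Proof.
by have := nbhs_dnbhs_neq (0 : R); apply: filterS => h h0 _.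
Qed.

Lemma has_derive_on_unique f s l l' :
  is_interval I -> I° !=set0 -> I s ->
  has_derive_on I f s l -> has_derive_on I f s l' -> l = l'.
Proof.
move=> itvI I0 Is; have ? := increments_proper itvI I0 Is.
by apply: cvg_unique.
Qed.

Lemma has_derive_on_ext f g s l : I s -> {in I, f =1 g} ->
  has_derive_on I f s l -> has_derive_on I g s l.
Proof.
move=> Is fg; apply: cvg_trans; apply: near_eq_cvg.
near=> h; rewrite !fg ?inE//.
by near: h; exact: near_increments_in.
Unshelve. all: by end_near. Qed.

Lemma has_derive_on_cst (c : R) s : has_derive_on I (cst c) s 0.
Proof.
rewrite /has_derive_on /cst subrr.
under eq_fun do rewrite mulr0.
exact: (cvg_cst (0 : R)).
Qed.

Lemma has_derive_onD f g s l l' :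
  has_derive_on I f s l -> has_derive_on I g s l' ->
  has_derive_on I (fun t => f t + g t) s (l + l').
Proof.
move=> df dg; apply: cvg_trans (cvgD df dg).
by apply: near_eq_cvg; apply: nearW => h; rewrite !fctE /=; ring.
Qed.

Lemma has_derive_onB f g s l l' :
  has_derive_on I f s l -> has_derive_on I g s l' ->
  has_derive_on I (fun t => f t - g t) s (l - l').
Proof.
move=> df dg; apply: cvg_trans (cvgB df dg).
by apply: near_eq_cvg; apply: nearW => h; rewrite !fctE /=; ring.
Qed.

Lemma has_derive_on_sum n (f : 'I_n -> R -> R) (l : 'I_n -> R) s :
  (forall i, has_derive_on I (f i) s (l i)) ->
  has_derive_on I (fun t => \sum_i f i t) s (\sum_i l i).
Proof.
move=> df; elim: (index_enum _) => [|i r IHr].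
  rewrite big_nil (_ : (fun t => _) = cst 0); first exact: has_derive_on_cst.
  by apply/funext => t; rewrite big_nil.
rewrite big_cons (_ : (fun t => _) = fun t => f i t + \sum_(j <- r) f j t).
  exact: has_derive_onD.
by apply/funext => t; rewrite big_cons.
Qed.

(** f (h + s) is h times the difference quotient, plus f s. *)
Lemma has_derive_on_continuous f s l : has_derive_on I f s l ->
  f (h + s) @[h --> increments I s] --> f s.
Proof.
move=> df.
have id0 : h @[h --> increments I s] --> (0 : R).
  by apply: cvg_within_filter; apply: cvg_within_filter; exact: cvg_id.
rewrite -[f s in X in _ --> X]add0r -(mul0r l).
apply: cvg_trans (cvgD (cvgM id0 df) (cvg_cst (f s))).
apply: near_eq_cvg; near=> h; rewrite !fctE.
rewrite /= mulrA mulfV ?mul1r ?subrK//.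
by near: h; exact: near_increments_neq0.
Unshelve. all: by end_near. Qed.

Lemma has_derive_onM f g s l l' :
  has_derive_on I f s l -> has_derive_on I g s l' ->
  has_derive_on I (fun t => f t * g t) s (l * g s + f s * l').
Proof.
move=> df dg.
apply: cvg_trans (cvgD (cvgM df (has_derive_on_continuous dg))
  (cvgM (cvg_cst (f s)) dg)).
by apply: near_eq_cvg; apply: nearW => h; rewrite !fctE /=; ring.
Qed.

Lemma has_derive_onZ (c : R) f s l :
  has_derive_on I f s l -> has_derive_on I (fun t => c * f t) s (c * l).
Proof.
move=> df; have := has_derive_onM (has_derive_on_cst c s) df.
by rewrite mul0r add0r.
Qed.

Lemma is_derive_has_derive_on f s l : is_derive s 1 f l -> has_derive_on I f s l.
Proof.
case=> df dl; apply: cvg_within_filter.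
rewrite -dl; have := df; rewrite /derivable /derive => /cvgP/=.
apply: cvg_trans; apply: near_eq_cvg; near=> h => /=.
by rewrite /shift /= [h *: 1]mulr1.
Unshelve. all: by end_near. Qed.

Lemma has_derive_on_interior f s l : I° s -> has_derive_on I f s l ->
  is_derive s 1 f l.
Proof.
move=> Is; rewrite /has_derive_on increments_interior// => df.
have df' : h^-1 *: ((f \o shift s) (h *: 1) - f s) @[h --> 0^'] --> l.
  move: df; apply: cvg_trans; apply: near_eq_cvg; near=> h => /=.
  by rewrite /shift /= [h *: 1]mulr1.
by apply: DeriveDef; [apply/cvg_ex; exists l|exact: cvg_lim df'].
Unshelve. all: by end_near. Qed.

(** [has_derive_on_continuous] concerns nonzero increments; the mean value theorem
    needs continuity along the points of A, the point s included. *)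
Lemma has_derive_on_within_continuous s f (A : set R) l : I s -> A `<=` I ->
  has_derive_on I f s l -> f t @[t --> within A (nbhs s)] --> f s.
Proof.
move=> Is AI /has_derive_on_continuous /cvgrPdist_le cf.
apply/cvgrPdist_le => e e0.
have near0 : \forall h \near (0 : R), h != 0 -> I (h + s) ->
  `|f s - f (h + s)| <= e := cf _ e0.
suff : \forall t \near s, A t -> `|f s - f t| <= e by [].
rewrite (near_shift 0) /=; apply: filterS near0 => h near0.
rewrite subr0 => /AI Ihs; have [->|h0] := eqVneq h 0; last exact: near0.
by rewrite add0r subrr normr0 ltW.
Qed.

(** The mean value theorem on the segment between two points of I: its inner
    points are interior to I, where the relative derivative is the usual one. *)
Lemma has_derive0_on_cst f : is_interval I ->
  (forall s, I s -> has_derive_on I f s 0) ->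
  forall s t, I s -> I t -> f s = f t.
Proof.
move=> itvI df.
suff H s t : I s -> I t -> s < t -> f t = f s.
  move=> s t Is It; have [st|ts|->//] := ltgtP s t; last exact: H.
  by apply/esym; exact: H.
move=> Is It st.
have sub : `[s, t]%classic `<=` I.
  by move=> u; rewrite /= in_itv => /= ust; apply: (itvI s t).
have [||c _] := @MVT _ f (cst 0) s t st.
- move=> u uin; apply: has_derive_on_interior; last first.
    apply: df; apply: sub; exact: subset_itv_oo_cc.
  rewrite /interior /=; apply: filterS (near_in_itvoo uin) => v vin.
  by apply: sub; exact: subset_itv_oo_cc.
- apply/subspace_continuousP => u uin.
  by apply: has_derive_on_within_continuous (sub _ uin) sub (df _ (sub _ uin)).
- by rewrite /cst mul0r => /subr0_eq.
Qed.

End ScalarCalculus.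

(** * Derivatives of vectors, dot products and cross products *)

Section VectorCalculus.
Variables (R : realType) (I : set R).
Implicit Types (u v : R -> 'rV[R]_3) (s : R).

(** Coordinatewise, which reduces every rule for vectors to its scalar case. *)
Definition has_vderive_on u s (l : 'rV[R]_3) :=
  forall i, has_derive_on I (fun t => u t 0 i) s (l 0 i).

Lemma cvg_has_vderive_on u s :
  cvg (h^-1 *: (u (h + s) - u s) @[h --> increments I s]) ->
  has_vderive_on u s (derive_on I u s).
Proof.
move=> du i.
have coordi := @coord_continuous R 1 3 0 i (derive_on I u s).
apply: cvg_trans (cvg_comp _ _ du coordi).
by apply: near_eq_cvg; apply: nearW => h; rewrite /= !mxE.
Qed.

Lemma has_vderive_on_dot u v s l l' :
  has_vderive_on u s l -> has_vderive_on v s l' ->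
  has_derive_on I (fun t => dot (u t) (v t)) s (dot l (v s) + dot (u s) l').
Proof.
move=> du dv; rewrite /dot -big_split.
by apply: has_derive_on_sum => i; apply: has_derive_onM.
Qed.

Lemma has_vderive_on_cross u v s l l' :
  has_vderive_on u s l -> has_vderive_on v s l' ->
  has_vderive_on (fun t => cross (u t) (v t)) s (cross l (v s) + cross (u s) l').
Proof.
move=> du dv i; rewrite !mxE.
rewrite addrACA -opprD (_ : (fun t => _) = fun t =>
  u t 0 (i + 1) * v t 0 (i + 2%:R) - u t 0 (i + 2%:R) * v t 0 (i + 1)).
  by apply: has_derive_onB; apply: has_derive_onM.
by apply/funext => t; rewrite mxE.
Qed.

(** The product rule and constancy give two values for the derivative of u.v, which
    agree by uniqueness.  Applied to orthonormality relations, this gives the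
    skew-symmetric pattern of the Frenet equations. *)
Lemma dot_cst_derive u v s l l' (c : R) :
  is_interval I -> I° !=set0 -> I s ->
  (forall t, I t -> dot (u t) (v t) = c) ->
  has_vderive_on u s l -> has_vderive_on v s l' ->
  dot l (v s) + dot (u s) l' = 0.
Proof.
move=> itvI I0 Is uvc du dv.
apply: (has_derive_on_unique itvI I0 Is (has_vderive_on_dot du dv)).
apply: has_derive_on_ext (has_derive_on_cst I c s) => // t.
by rewrite inE => /uvc ->.
Qed.

End VectorCalculus.

(** * Dot and cross products *)

Section DotCross.
Variable R : realType.
Implicit Types u v w : 'rV[R]_3.

Lemma dotC u v : dot u v = dot v u.
Proof. by apply: eq_bigr => i _; rewrite mulrC. Qed.

Lemma dotDl u v w : dot (u + v) w = dot u w + dot v w.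
Proof. by rewrite /dot -big_split; apply: eq_bigr => i _; rewrite !mxE mulrDl. Qed.

Lemma dotZl (c : R) u v : dot (c *: u) v = c * dot u v.
Proof. by rewrite /dot big_distrr; apply: eq_bigr => i _; rewrite !mxE /= mulrA. Qed.

Lemma dotZr (c : R) u v : dot u (c *: v) = c * dot u v.
Proof. by rewrite dotC dotZl dotC. Qed.

Lemma dot_ge0 u : 0 <= dot u u.
Proof. by apply: sumr_ge0 => i _; rewrite -expr2 sqr_ge0. Qed.

Lemma dot_enorm u : dot u u = enorm u ^+ 2.
Proof. by rewrite sqr_sqrtr // dot_ge0. Qed.

Let coord_cross u v :
  ((cross u v 0 0 = u 0 1 * v 0 2%:R - u 0 2%:R * v 0 1) *
   (cross u v 0 1 = u 0 2%:R * v 0 0 - u 0 0 * v 0 2%:R) *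
   (cross u v 0 2%:R = u 0 0 * v 0 1 - u 0 1 * v 0 0))%type.
Proof.
by do !split; rewrite mxE; congr (u _ _ * v _ _ - u _ _ * v _ _); apply: val_inj.
Qed.

Let dot3 u v : dot u v = u 0 0 * v 0 0 + u 0 1 * v 0 1 + u 0 2%:R * v 0 2%:R.
Proof.
rewrite /dot !big_ord_recl big_ord0 addr0 addrA.
by congr (u _ _ * v _ _ + u _ _ * v _ _ + u _ _ * v _ _); apply: val_inj.
Qed.

Lemma dot_crossl u v : dot u (cross u v) = 0.
Proof. by rewrite dot3 !coord_cross; ring. Qed.

Lemma dot_crossr u v : dot v (cross u v) = 0.
Proof. by rewrite dot3 !coord_cross; ring. Qed.

(** Lagrange's identity; it makes the binormal of a unit orthogonal pair a unit
    vector. *)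
Lemma dot_cross_cross u v :
  dot (cross u v) (cross u v) = dot u u * dot v v - dot u v ^+ 2.
Proof. by rewrite !dot3 !coord_cross; ring. Qed.

End DotCross.

(** * The Frenet frame and the coordinates of the position vector *)

Section Frenet.
Variables (R : realType) (I : set R) (x : R -> 'rV[R]_3) (k1 k2 : R).
Hypothesis x_unit : unit_speed_curve I x.
Hypothesis x_W : W_curve I x k1 k2.
Hypothesis k1_neq0 : k1 != 0.

Local Notation T := (frenetT I x).
Local Notation N1 := (frenetN1 I x).
Local Notation N2 := (frenetN2 I x).

Let itvI : is_interval I. Proof. by case: x_unit. Qed.
Let I0 : I° !=set0. Proof. by case: x_unit. Qed.

Lemma position_vderive s : I s -> has_vderive_on I x s (T s).
Proof.
by case: x_unit => _ _ [dx _ _] _ Is; apply: cvg_has_vderive_on; apply: dx.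
Qed.

Lemma frenetT_vderive s : I s -> has_vderive_on I T s (k1 *: N1 s).
Proof.
move=> Is; rewrite /frenetN1 (x_W Is).1 scalerA divff// scale1r.
by apply: cvg_has_vderive_on; case: x_unit => _ _ [_ dT _] _; apply: dT.
Qed.

(** N1 is a multiple of T' by a factor that is the same at all points of I, so it
    is differentiable because x is three times differentiable. *)
Lemma frenetN1_vderive s : I s ->
  has_vderive_on I N1 s (derive_on I N1 s).
Proof.
move=> Is; apply: cvg_has_vderive_on.
have [_ _ [_ _ ddT] _] := x_unit.
apply/cvg_ex; exists (k1^-1 *: derive_on I (derive_on I T) s).
apply: cvg_trans (cvgZl_tmp (k := k1^-1) (ddT s Is)).
apply: near_eq_cvg; near=> h => /=.
have Ihs : I (h + s) by near: h; exact: near_increments_in.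
by rewrite /frenetN1 (x_W Is).1 (x_W Ihs).1 -scalerBr !scalerA mulrC.
Unshelve. all: by end_near. Qed.

Lemma dotTT s : I s -> dot (T s) (T s) = 1.
Proof. by move=> Is; rewrite dot_enorm; case: x_unit => _ _ _ ->; rewrite ?expr1n. Qed.

Lemma dotTN1 s : I s -> dot (T s) (N1 s) = 0.
Proof.
move=> Is; have := dot_cst_derive itvI I0 Is dotTT
  (frenetT_vderive Is) (frenetT_vderive Is).
rewrite dotC -mulr2n dotZr => /eqP.
by rewrite mulrn_eq0 mulf_eq0 (negPf k1_neq0) => /eqP.
Qed.

Lemma dotN1N1 s : I s -> dot (N1 s) (N1 s) = 1.
Proof.
move=> Is; rewrite dotZl dotZr dot_enorm -/(curvature I x s) (x_W Is).1.
by field.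
Qed.

Lemma dotTN2 s : dot (T s) (N2 s) = 0.
Proof. exact: dot_crossl. Qed.

Lemma dotN1N2 s : dot (N1 s) (N2 s) = 0.
Proof. exact: dot_crossr. Qed.

Lemma dotN2N2 s : I s -> dot (N2 s) (N2 s) = 1.
Proof.
by move=> Is; rewrite dot_cross_cross dotTT// dotN1N1// dotTN1// expr0n mulr1 subr0.
Qed.

Section Position.
Variables m0 m1 m2 : R -> R.
Hypothesis xE : forall s, I s -> x s = m0 s *: T s + m1 s *: N1 s + m2 s *: N2 s.

(** Each m_i is the dot product of x with a frame vector E_i, and m_i' is
    T.E_i + x.E_i'.  Since x is itself a combination of the frame vectors, the
    only information needed on E_i' is its dot products with the frame. *)
Lemma position_derive s : I s ->
  [/\ has_derive_on I m0 s (1 + k1 * m1 s),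
      has_derive_on I m1 s (- k1 * m0 s + k2 * m2 s) &
      has_derive_on I m2 s (- k2 * m1 s)].
Proof.
move=> Is.
have dx := position_vderive Is.
have dT := frenetT_vderive Is.
have dN1 := frenetN1_vderive Is.
have [D2 dN2] : exists D2, has_vderive_on I N2 s D2.
  by eexists; apply: has_vderive_on_cross dT dN1.
have D1N2 : dot (derive_on I N1 s) (N2 s) = k2 := (x_W Is).2.
move: (derive_on I N1 s) dN1 D1N2 => D1 dN1 D1N2.
have cstE := dot_cst_derive itvI I0 Is.
have N1D1 : dot (N1 s) D1 = 0.
  by have := cstE _ _ _ _ _ dotN1N1 dN1 dN1; rewrite dotC; lra.
have TD1 : dot (T s) D1 = - k1.
  have := cstE _ _ _ _ _ dotTN1 dT dN1; rewrite dotZl dotN1N1// mulr1; lra.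
have N2D2 : dot (N2 s) D2 = 0.
  by have := cstE _ _ _ _ _ dotN2N2 dN2 dN2; rewrite dotC; lra.
have TD2 : dot (T s) D2 = 0.
  have := cstE _ _ _ _ _ (fun t _ => dotTN2 t) dT dN2.
  by rewrite dotZl dotN1N2 mulr0 add0r.
have N1D2 : dot (N1 s) D2 = - k2.
  by have := cstE _ _ _ _ _ (fun t _ => dotN1N2 t) dN1 dN2; rewrite D1N2; lra.
have xdot t w : I t -> dot (x t) w =
    m0 t * dot (T t) w + m1 t * dot (N1 t) w + m2 t * dot (N2 t) w.
  by move=> It; rewrite xE// !dotDl !dotZl.
have m0E t : I t -> dot (x t) (T t) = m0 t.
  by move=> It; rewrite xdot// dotTT// dotC dotTN1// dotC dotTN2; ring.
have m1E t : I t -> dot (x t) (N1 t) = m1 t.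
  move=> It; rewrite xdot// dotTN1// dotN1N1// (dotC (N2 t)) dotN1N2; ring.
have m2E t : I t -> dot (x t) (N2 t) = m2 t.
  by move=> It; rewrite xdot// dotTN2 dotN1N2 dotN2N2//; ring.
split.
- have := has_vderive_on_dot dx dT.
  rewrite dotTT// dotZr m1E//; apply: has_derive_on_ext => // t.
  by rewrite inE => /m0E.
- have := has_vderive_on_dot dx dN1.
  rewrite dotTN1// xdot// TD1 N1D1 (dotC (N2 s)) D1N2.
  have -> : 0 + (m0 s * - k1 + m1 s * 0 + m2 s * k2) = - k1 * m0 s + k2 * m2 s.
    by ring.
  by apply: has_derive_on_ext => // t; rewrite inE => /m1E.
- have := has_vderive_on_dot dx dN2.
  rewrite dotTN2// xdot// TD2 N1D2 N2D2.
  have -> : 0 + (m0 s * 0 + m1 s * - k2 + m2 s * 0) = - k2 * m1 s by ring.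
  by apply: has_derive_on_ext => // t; rewrite inE => /m2E.
Qed.

End Position.
End Frenet.

(** * Integration of the linear system *)

Lemma W_curve_ode_solution (R : realType) (I : set R) (m0 m1 m2 : R -> R)
    (k1 k2 : R) :
  is_interval I -> I !=set0 -> k1 != 0 ->
  (forall s, I s ->
    [/\ has_derive_on I m0 s (1 + k1 * m1 s),
        has_derive_on I m1 s (- k1 * m0 s + k2 * m2 s) &
        has_derive_on I m2 s (- k2 * m1 s)]) ->
  let a := Num.sqrt (k1 ^+ 2 + k2 ^+ 2) in
  let b := k1 / a ^+ 2 in
  exists c0 c1 c2 c3 : R, forall s, I s ->
    [/\ m0 s = k1 * ((c3 * sin (a * s) - c2 * cos (a * s)) / a - b * s)
               + s + c0,
        m1 s = c2 * sin (a * s) + c3 * cos (a * s) - b &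
        m2 s = - k2 * ((c3 * sin (a * s) - c2 * cos (a * s)) / a - b * s)
               + c1].
Proof.
move=> itvI [s0 Is0] k1_neq0 dm a b.
have a2_gt0 : 0 < k1 ^+ 2 + k2 ^+ 2.
  by rewrite ltr_pwDl ?sqr_ge0// exprn_even_gt0.
have a2E : a ^+ 2 = k1 ^+ 2 + k2 ^+ 2 by rewrite sqr_sqrtr// ltW.
have a_neq0 : a != 0 by rewrite gt_eqF// sqrtr_gt0.
have dlin (s : R) : is_derive s (1 : R) ( *%R a) a.
  have := @is_deriveZ R R R id a s 1 1 (is_derive_id s 1).
  by rewrite [a *: 1]mulr1.
have dsin s : has_derive_on I (fun t => sin (a * t)) s (a * cos (a * s)).
  by apply: is_derive_has_derive_on; rewrite mulrC; exact: is_derive1_comp.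
have dcos s : has_derive_on I (fun t => cos (a * t)) s (a * - sin (a * s)).
  by apply: is_derive_has_derive_on; rewrite mulrC; exact: is_derive1_comp.
have did s : has_derive_on I (fun t => t) s 1.
  by apply: is_derive_has_derive_on; exact: is_derive_id.
have first_integral F : (forall s, I s -> has_derive_on I F s 0) ->
    exists c, forall s, I s -> F s = c.
  by move=> dF; exists (F s0) => s Is; exact: (has_derive0_on_cst itvI dF).
pose Q t := - k1 * m0 t + k2 * m2 t.
pose P t := m1 t + b.
have dP s : I s -> has_derive_on I P s (Q s).
  move=> Is; have [_ dm1 _] := dm s Is.
  have := has_derive_onD dm1 (has_derive_on_cst I b s).
  by rewrite addr0.
have dQ s : I s -> has_derive_on I Q s (- a ^+ 2 * P s).
  move=> Is; have [dm0 _ dm2] := dm s Is.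
  have := has_derive_onD (has_derive_onZ (c := - k1) dm0)
    (has_derive_onZ (c := k2) dm2).
  have -> // : - k1 * (1 + k1 * m1 s) + k2 * (- k2 * m1 s) = - a ^+ 2 * P s.
  have -> : - a ^+ 2 * P s = - a ^+ 2 * m1 s - k1 by rewrite /P /b; field.
  by rewrite a2E; ring.
(* (P, Q / a) rotates at angular speed a, so rotating it back gives constants. *)
have [c2 c2E] : exists c, forall s, I s ->
    P s * sin (a * s) + a^-1 * (Q s * cos (a * s)) = c.
  apply: first_integral => s Is.
  have := has_derive_onD (has_derive_onM (dP s Is) (dsin s))
    (has_derive_onZ (c := a^-1) (has_derive_onM (dQ s Is) (dcos s))).
  by congr has_derive_on; field.
have [c3 c3E] : exists c, forall s, I s ->
    P s * cos (a * s) - a^-1 * (Q s * sin (a * s)) = c.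
  apply: first_integral => s Is.
  have := has_derive_onB (has_derive_onM (dP s Is) (dcos s))
    (has_derive_onZ (c := a^-1) (has_derive_onM (dQ s Is) (dsin s))).
  by congr has_derive_on; field.
(* For a W-curve k2 T + k1 N2 is a constant vector, the axis of the helix, so the
   component of x along it is affine in s. *)
have [c cE] : exists c, forall s, I s -> k2 * m0 s + k1 * m2 s - k2 * s = c.
  apply: first_integral => s Is; have [dm0 _ dm2] := dm s Is.
  have := has_derive_onB (has_derive_onD (has_derive_onZ (c := k2) dm0)
    (has_derive_onZ (c := k1) dm2)) (has_derive_onZ (c := k2) (did s)).
  by congr has_derive_on; ring.
(* Solve k2 m0 + k1 m2 = k2 s + c and - k1 m0 + k2 m2 = Q: the terms in c give
   c0 and c1, and k2^2 / a^2 = 1 - k1 b accounts for the term s of m0. *)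
exists (k2 * c / a ^+ 2), (k1 * c / a ^+ 2), c2, c3 => s Is.
have cs1 := cos2Dsin2 (a * s).
have PE : P s = c2 * sin (a * s) + c3 * cos (a * s).
  rewrite -(c2E s Is) -(c3E s Is) -[LHS]mulr1 -cs1; ring.
have QE : - Q s / a ^+ 2 = (c3 * sin (a * s) - c2 * cos (a * s)) / a.
  rewrite -(c2E s Is) -(c3E s Is) -[Q s in LHS]mulr1 -cs1; field.
  exact: a_neq0.
rewrite -QE -PE -(cE s Is) /P /Q /b a2E.
have a2_neq0 : k1 ^+ 2 + k2 ^+ 2 != 0 by rewrite gt_eqF.
by split; field.
Qed.

Theorem proposition1 (R : realType) (I : set R) (x : R -> 'rV[R]_3)
    (m0 m1 m2 : R -> R) (k1 k2 : R) :
  unit_speed_curve I x ->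
  twisted I x ->
  (forall s, I s -> 0 < curvature I x s) ->
  (forall s, I s ->
     x s = m0 s *: frenetT I x s + m1 s *: frenetN1 I x s
           + m2 s *: frenetN2 I x s) ->
  W_curve I x k1 k2 ->
  let a := Num.sqrt (k1 ^+ 2 + k2 ^+ 2) in
  let b := k1 / a ^+ 2 in
  exists c0 c1 c2 c3 : R, forall s, I s ->
    [/\ m0 s = k1 * ((c3 * sin (a * s) - c2 * cos (a * s)) / a - b * s)
               + s + c0,
        m1 s = c2 * sin (a * s) + c3 * cos (a * s) - b &
        m2 s = - k2 * ((c3 * sin (a * s) - c2 * cos (a * s)) / a - b * s)
               + c1].
Proof.
move=> x_unit x_twisted _ xE x_W.
have [itvI [p /interior_subset Ip] _ _] := x_unit.
have k1_neq0 : k1 != 0 by rewrite -(x_W p Ip).1; case: (x_twisted p Ip).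
apply: W_curve_ode_solution => //; first by exists p.
by move=> s; apply: position_derive x_unit x_W k1_neq0 _ _ _ xE s.
Qed.
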